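(* There exists a charming space $X$ such that (1) $X$ is not a Lindelöf $\Sigma$-space, and (2) the square $X^{2}=X\times X$ is not a charming space.
   Context: All spaces are Tychonoff. A perfect map is a continuous closed map with compact fibres. A space $X$ is a Lindelöf $\Sigma$-space if there exists a space $Z$ which maps continuously onto $X$ and perfectly onto a second countable space. A space $X$ is charming if there is a subspace $Y\subset X$ that is a Lindelöf $\Sigma$-space and such that for each open set $U$ of $X$ with $Y\subset U$, the subspace $X\setminus U$ is a Lindelöf $\Sigma$-space. *)

(* Defs.v *)
From mathcomp Require Import all_boot all_order all_algebra.
From mathcomp Require Import all_classical all_reals all_analysis.

Set Implicit Arguments.
Unset Strict Implicit.
Unset Printing Implicit Defensive.

Local Open Scope classical_set_scope.

(* [completely_regular_space] separates points from closed sets by uniform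
   separators; [uniform_separatorP] turns these into continuous functions
   with values in [0, 1] over any [realType]. *)
Definition tychonoff_space (X : topologicalType) : Prop :=
  hausdorff_space X /\ completely_regular_space X.

(* Perfect maps need not be surjective. *)
Definition perfect_map (X Y : topologicalType) (f : X -> Y) : Prop :=
  [/\ continuous f,
      forall A : set X, closed A -> closed (f @` A)
    & forall y : Y, compact (f @^-1` [set y])].

(* [lindelof_sigma] and [charming] are meant for Tychonoff [X]: the witnesses
   [Z] and [M] are required to be Tychonoff, but [X] itself is not, so the
   hypothesis [tychonoff_space X] has to be stated separately. *)
Definition lindelof_sigma (X : topologicalType) : Prop :=
  exists (Z M : topologicalType) (f : Z -> X) (p : Z -> M),
    [/\ tychonoff_space Z,
        tychonoff_space M /\ @second_countable M,
        continuous f /\ range f = [set: X]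
      & perfect_map p /\ range p = [set: M]].

(* A set coerces to the corresponding subtype, whose canonical topology is the
   one induced by the inclusion; so [Y : set X] is used here as a space. *)
Definition charming (X : topologicalType) : Prop :=
  exists2 Y : set X, lindelof_sigma Y &
    forall U : set X, open U -> Y `<=` U -> lindelof_sigma (~` U).

(* Main.v *)
Require Import Defs.
From HB Require Import structures.
From mathcomp Require Import all_boot all_order all_algebra.
From mathcomp Require Import all_classical all_reals all_analysis.

(** Let [X] be the one-point Lindelöfication of an uncountable discrete space,
    with point at infinity [None].  It is charming, with [{None}] as kernel,
    because the complement of a neighbourhood of [None] is countable and
    discrete.  Countable subsets of [X] are closed, and this makes every
    continuous image in [X] of a Lindelöf Sigma-space countable; in particular
    [X] is not Lindelöf Sigma.  If [Y] is a Lindelöf Sigma-subspace of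
    [X * X], its first projection is therefore countable and misses some
    isolated point [d]; the clopen set [{d} * X] is disjoint from [Y] and
    projects onto [X], so it is not Lindelöf Sigma. *)

Set Implicit Arguments.
Unset Strict Implicit.
Unset Printing Implicit Defensive.

Local Open Scope classical_set_scope.

(** The separating uniformity is pulled back from discrete [bool] along the characteristic function
    [f] of [V]; the kernel of [f] is an entourage disjoint from [A] times [B]. *)
Lemma clopen_uniform_separator (T : topologicalType) (A B V : set T) :
  clopen V -> A `<=` V -> B `<=` ~` V -> uniform_separator A B.
Proof.
move=> [oV cV] AV BV.
pose f (x : T) : bool := x \in V.
pose T' : uniformType := initial_topology f.
exists (Uniform.class T'), [set xy | f xy.1 = f xy.2]; split.
- exists [set xy : bool * bool | xy.1 = xy.2]; last by case.
  by move=> [a b] [c _ [<- <-]].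
- rewrite -subset0 => -[a b [[/= /AV Va /BV Vb]]].
  by rewrite /f (mem_set Va) memNset.
- move=> x U [W [[S oS <-] /= Sx]] WU.
  have [Vx|nVx] := pselect (V x).
    apply: (@filterS _ _ _ V); last exact: open_nbhs_nbhs.
    by move=> y Vy; apply: WU; move: Sx; rewrite /f /= (mem_set Vx) (mem_set Vy).
  apply: (@filterS _ _ _ (~` V)).
    by move=> y Vy; apply: WU; move: Sx; rewrite /f /= !memNset.
  by apply: open_nbhs_nbhs; split => //; exact: closed_openC.
Qed.

Lemma clopen_base_tychonoff (T : topologicalType) :
  (forall x : T, closed [set x]) ->
  (forall (x : T) (U : set T), open U -> U x ->
     exists V, [/\ clopen V, V x & V `<=` U]) ->
  tychonoff_space T.
Proof.
move=> T1 base; split.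
  rewrite open_hausdorff => x y /eqP xy.
  have [V [[oV cV] Vx Vy]] := base x (~` [set y]) (closed_openC (T1 y)) xy.
  exists (V, ~` V); split => /=.
  - exact/mem_set.
  - by apply/mem_set => /Vy; apply.
  - exact: oV.
  - exact: closed_openC.
  - by rewrite setICr.
move=> x B cB nBx.
have [V [clV Vx VB]] := base x (~` B) (closed_openC cB) nBx.
apply: (clopen_uniform_separator clV) => [_ -> //|y By Vy].
exact: VB Vy By.
Qed.

(** The singletons form a countable base, so the identity serves as both maps. *)
Lemma countable_discrete_lindelof_sigma (T : topologicalType) :
  countable [set: T] -> (forall A : set T, closed A) -> lindelof_sigma T.
Proof.
move=> cT clT.
have opT (A : set T) : open A by rewrite -(setCK A); apply: closed_openC; exact: clT.
have tyT : tychonoff_space T.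
  apply: clopen_base_tychonoff => [x|x U oU Ux]; first exact: clT.
  by exists U; split => //; split.
have contid : continuous (@id T) by move=> x A.
exists T, T, id, id; split => //.
- split => //; exists (range (@set1 T)).
    exact: sub_countable (card_image_le _ _) cT.
  split => [A _|x U /nbhs_singleton Ux]; first exact: opT.
  by exists [set x] => [|y -> //]; split => //; exists x.
- by split => //; rewrite image_id.
- split; last by rewrite image_id.
  by split => // y; exact: compact_set1.
Qed.

Section countable_sets_closed.
Context {X : topologicalType}.
Hypothesis cclosed : forall C : set X, countable C -> closed C.

(** An injective sequence in [K] would have a cluster point. Its tails are countable, hence closed,
    so each contains that point, which is then a term with two different indices. *)
Lemma compact_finite (K : set X) : compact K -> finite_set K.
Proof.
move=> cK; apply: contrapT => /infiniteP /card_leP [g].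
pose u (n : nat) : X := \val (g (to_setT n)).
have u_inj : injective u.
  move=> m n /val_inj gmn.
  have := @inj _ _ _ g (to_setT m) (to_setT n).
  by rewrite !inE => /(_ I I gmn) /(congr1 val).
have [x [_ xu]] : K `&` cluster (u @ \oo) !=set0.
  by apply: cK; exists 0%N => // n _; exact: set_valP.
pose tail (n : nat) := u @` [set k | (n <= k)%N].
have tailx n : tail n x.
  have /closure_id -> : closed (tail n).
    by apply: cclosed; apply: sub_countable (card_image_le _ _) _.
  have := xu; rewrite clusterE; apply.
  by exists n => // k /= nk; exists k.
have [m _ um] := tailx 0%N; have [k /= mk uk] := tailx m.+1.
have /u_inj km : u k = u m by rewrite um.
by move: mk; rewrite km ltnn.
Qed.

(* A basic neighbourhood [b] of [p z] is bad if [f @` (p @^-1` b)] has a point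
   outside the finite set [f @` (p @^-1` [set p z])].  If all were, the
   countable set [C] of these points would be closed, and the complement of
   [p @` (f @^-1` C)] an open neighbourhood of [p z] containing no [b]. *)
Lemma countable_range_of_perfect (Z M : topologicalType) (f : Z -> X)
    (p : Z -> M) :
  @second_countable M -> continuous f -> perfect_map p -> countable (range f).
Proof.
move=> [B cB [_ Bbase]] cf [cp clp kp].
have fiber_fin z : finite_set (f @` (p @^-1` [set p z])).
  apply: compact_finite; apply: continuous_compact; last exact: kp.
  exact: continuous_subspaceT.
pose G := [set b | B b /\ countable (f @` (p @^-1` b))].
suff Gcover : range f `<=` \bigcup_(b in G) f @` (p @^-1` b).
  apply: sub_countable (subset_card_le Gcover) _.
  apply: bigcup_countable => [|b [] //].
  by apply: sub_countable cB; apply: subset_card_le => b [].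
move=> _ [z _ <-].
apply: contrapT => nz.
have bad b : exists y, B b -> b (p z) ->
    (f @` (p @^-1` b)) y /\ ~ (f @` (p @^-1` [set p z])) y.
  have [[Bb bz]|nb] := pselect (B b /\ b (p z)); last first.
    by exists (f z) => Bb bz; exfalso; apply: nb.
  apply: contrapT => /forallNP nex; apply: nz.
  exists b; last by exists z.
  split=> //; apply: sub_countable (finite_set_countable (fiber_fin z)).
  apply: subset_card_le => y fy; apply: contrapT => ny.
  by apply: (nex y).
have [y yP] := choice bad.
pose C := y @` [set b | B b /\ b (p z)].
have cC : closed C.
  apply: cclosed; apply: sub_countable (card_image_le _ _) _.
  by apply: sub_countable cB; apply: subset_card_le => b [].
have : nbhs (p z) (~` (p @` (f @^-1` C))).
  apply: open_nbhs_nbhs; split.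
    by apply/closed_openC/clp; move/continuous_closedP: cf; apply.
  move=> [w [b [Bb bz] ybw] pw].
  by have [_] := yP b Bb bz; apply; exists w.
move/Bbase => [b [Bb bz] bC].
have [[w pw fw] _] := yP b Bb bz.
by apply: (bC _ pw); exists w => //; exists b.
Qed.

(** The map [g] is arbitrary so that projections restricted to subspaces of a square are covered. *)
Lemma lindelof_sigma_countable_range (T : topologicalType) (g : T -> X) :
  continuous g -> lindelof_sigma T -> countable (range g).
Proof.
move=> cg [Z [M [f [p [_ [_ sM] [cf fT] [pp _]]]]]].
rewrite -fT image_comp.
apply: (countable_range_of_perfect sM _ pp) => z.
by apply: continuous_comp; [exact: cf|exact: cg].
Qed.

End countable_sets_closed.

(** The alias carries the topology, so that none is put on [option] itself. *)
Definition lindelofication (D : choiceType) : Type := option D.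

Section lindelofication.
Variable D : choiceType.

HB.instance Definition _ := Choice.on (lindelofication D).

Let op : set_system (lindelofication D) :=
  [set A | A None -> countable (~` A)].

Let opT : op setT.
Proof. by rewrite /op /= setCT. Qed.

Let opI : setI_closed op.
Proof.
move=> A B opA opB [/opA cA /opB cB].
rewrite setCI -bigcup2E; apply: bigcup_countable => // -[|[|i]] _ //=.
Qed.

Let op_bigU (I : Type) (F : I -> set (lindelofication D)) :
  (forall i, op (F i)) -> op (\bigcup_i F i).
Proof.
move=> opF [i _ /opF cFi]; apply: sub_countable cFi; apply: subset_card_le.
by apply: subsetC; exact: bigcup_sup.
Qed.

HB.instance Definition _ :=
  isOpenTopological.Build (lindelofication D) opT opI op_bigU.

Local Notation X := (lindelofication D).

Lemma lindelofication_openE (A : set X) :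
  open A = (A None -> countable (~` A)).
Proof. by []. Qed.

Lemma lindelofication_closedE (A : set X) :
  closed A = (~ A None -> countable A).
Proof. by rewrite -openC lindelofication_openE setCK. Qed.

Lemma lindelofication_countable_closed (A : set X) : countable A -> closed A.
Proof. by rewrite lindelofication_closedE. Qed.

Lemma lindelofication_tychonoff : tychonoff_space X.
Proof.
apply: clopen_base_tychonoff => [x|x U oU Ux].
  exact: lindelofication_countable_closed.
(* Every set containing [None] is closed, so an open one is its own clopen neighbourhood; otherwise
   [x] is isolated. *)
have [UN|nUN] := pselect (U None).
  by exists U; split => //; split => //; rewrite lindelofication_closedE.
case: x Ux => // d Ud; exists [set Some d : X]; split => //; last first.
  by move=> _ ->.
split; last exact: lindelofication_countable_closed.
by rewrite lindelofication_openE.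
Qed.

(** Each subset of [A] is countable, hence closed in [X], so [A] is discrete. *)
Lemma countable_lindelof_sigma (A : set X) : countable A -> lindelof_sigma A.
Proof.
move=> cA; apply: countable_discrete_lindelof_sigma.
  by rewrite (eq_countable (card_setT _)).
move=> C; have -> : C = set_val @^-1` (set_val @` C).
  apply/seteqP; split => [x Cx|x [y Cy /val_inj <-]]; last exact: Cy.
  by exists x.
apply: preimage_closed; first by move=> x _; exact: initial_continuous.
apply: lindelofication_countable_closed; apply: sub_countable cA.
by apply: subset_card_le => _ [x _ <-]; exact: set_valP.
Qed.

Lemma lindelofication_charming : charming X.
Proof.
exists [set None]; first exact: countable_lindelof_sigma.
move=> U oU /(_ None erefl) UN; apply: countable_lindelof_sigma.
by move: oU; rewrite lindelofication_openE; apply.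
Qed.

Hypothesis uncountableD : ~ countable [set: D].

Lemma uncountable_isolated : ~ countable ((Some : D -> X) @` [set: D]).
Proof. by rewrite (eq_countable (inj_card_eq _)) // => x y _ _ []. Qed.

Lemma uncountable_lindelofication : ~ countable [set: X].
Proof.
by move=> cX; apply: uncountable_isolated; apply: sub_countable (card_leT _) cX.
Qed.

Lemma lindelofication_not_lindelof_sigma : ~ lindelof_sigma X.
Proof.
move=> /(lindelof_sigma_countable_range lindelofication_countable_closed
  (g := id)) cX.
by apply: uncountable_lindelofication; rewrite -[setT]image_id; apply: cX => x A.
Qed.

Lemma lindelofication_square_not_charming : ~ charming (X * X)%type.
Proof.
move=> [Y LY Ycompl].
have cval (A : set (X * X)) : continuous (set_val : A -> X * X).
  exact: initial_continuous.
have cproj (g : X * X -> X) (A : set (X * X)) :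
    continuous g -> lindelof_sigma A -> countable (g @` A).
  move=> cg /(lindelof_sigma_countable_range lindelofication_countable_closed
    (g := g \o set_val)) cA.
  apply: sub_countable (cA _); last first.
    by move=> x; apply: continuous_comp; [exact: cval|exact: cg].
  apply: subset_card_le => _ [x Ax <-].
  by exists (SigSub (mem_set Ax)).
have cY : countable (fst @` Y) by apply: cproj LY => x; exact: cvg_fst.
have [d nYd] : exists d : D, ~ (fst @` Y) (Some d).
  apply: contrapT => /forallNP Yall; apply: uncountable_isolated.
  apply: sub_countable cY; apply: subset_card_le => _ [d _ <-].
  by apply: contrapT; exact: Yall.
pose U : set (X * X) := fst @^-1` (~` [set Some d]).
have oU : open U.
  apply: (@open_comp _ _ (fst : X * X -> X)) => [x _|]; first exact: cvg_fst.
  by apply: closed_openC; exact: lindelofication_countable_closed.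
have YU : Y `<=` U by move=> x Yx /= xd; apply: nYd; exists x.
(* The complement of [U] is the slice over [Some d], which [snd] maps onto [X]. *)
have /(cproj snd) cX := Ycompl U oU YU.
apply: uncountable_lindelofication; apply: sub_countable (cX _).
  by apply: subset_card_le => x _; exists (Some d, x) => //=; apply.
by move=> x; exact: cvg_snd.
Qed.

End lindelofication.

(** Cantor's diagonal argument: [S] collects the codes [g A] that lie outside [A]. *)
Lemma uncountable_nat_set : ~ countable [set: set nat].
Proof.
move=> /countable_injP [g g_inj].
pose S : set nat := [set n | exists2 A, g A = n & ~ A n].
have [SgS|nSgS] := pselect (S (g S)).
  have [A gA nA] := SgS; apply: nA.
  by rewrite (g_inj A S _ _ gA) ?inE.
by apply: (nSgS); exists S.
Qed.

Theorem mainTheorem1 :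
  exists X : topologicalType,
    [/\ tychonoff_space X, charming X, ~ lindelof_sigma X & ~ charming (X * X)%type].
Proof.
exists (lindelofication (set nat)); split.
- exact: lindelofication_tychonoff.
- exact: lindelofication_charming.
- exact: lindelofication_not_lindelof_sigma uncountable_nat_set.
- exact: lindelofication_square_not_charming uncountable_nat_set.
Qed.
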